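(* Let $X$ be a Hadamard space, $C\subseteq X$ closed and convex, and let $T_k:C\to C$ ($k\ge 1$) be a strongly quasi-nonexpansive sequence satisfying the demiclosedness condition (D). Let $x_0\in C$ and define $x_{k+1}=T_kT_{k-1}\cdots T_1x_0$ for $k\ge 1$. Then the sequence $\{x_k\}$ $\Delta$-converges to an element of $\bigcap_kF(T_k)$.
   Context: A Hadamard space is a complete CAT(0) space. For a bounded sequence $\{x_k\}$ in $X$ the asymptotic center is the set of minimizers over $x\in X$ of $\limsup_k d(x,x_k)$ (in a Hadamard space, exactly one point). $\{x_k\}$ $\Delta$-converges to $x$ if every subsequence of $\{x_k\}$ has asymptotic center $\{x\}$. $F(T)=\{x\in C: Tx=x\}$. $T:C\to C$ is quasi-nonexpansive if $F(T)\ne\varnothing$ and $d(Tx,q)\le d(x,q)$ for all $x\in C$, $q\in F(T)$. A sequence $\{T_k\}$ of quasi-nonexpansive mappings $C\to C$ is a strongly quasi-nonexpansive sequence if $\bigcap_kF(T_k)\neq\varnothing$ and $d(x_k,T_kx_k)\to 0$ whenever $\{x_k\}$ is a bounded sequence in $C$ such that $d(x_k,q)-d(T_kx_k,q)\to 0$ for some $q\in\bigcap_kF(T_k)$. Condition (D): for every sequence $\{x_k\}$ in $C$ and every strictly increasing sequence of indices $\{k_j\}$, if $x_{k_j}$ $\Delta$-converges to $p\in C$ and $\lim_j d(x_{k_j},T_{k_j}x_{k_j})=0$, then $p\in\bigcap_kF(T_k)$. *)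

(* Defs.v *)
From mathcomp Require Import all_boot all_order all_algebra.
From mathcomp Require Import all_classical all_reals all_analysis.
Set Implicit Arguments.
Unset Strict Implicit.
Unset Printing Implicit Defensive.
Import Order.TTheory GRing.Theory Num.Theory.
Import numFieldNormedType.Exports.
Local Open Scope classical_set_scope.
Local Open Scope ring_scope.

Section Plane.
Context {R : realType}.

(* The library's own norm on ['rV[R]_2] is the sup norm, hence this explicit
   Euclidean distance. *)
Definition edist (a b : 'rV[R]_2) : R :=
  Num.sqrt (\sum_(i < 2) (a ord0 i - b ord0 i) ^+ 2).

Definition esegment (a b : 'rV[R]_2) : set 'rV[R]_2 :=
  [set (1 - s) *: a + s *: b | s in `[0, 1]].

End Plane.

Section Hadamard.
Context {R : realType} {X : metricType R}.

Definition geodesic (c : R -> X) (x y : X) : Prop :=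
  [/\ c 0 = x, c (mdist x y) = y &
      forall s t : R, s \in `[0, mdist x y] -> t \in `[0, mdist x y] ->
        mdist (c s) (c t) = `|s - t|].

Definition gsegment (c : R -> X) (x y : X) : set X :=
  c @` `[0, mdist x y].

Definition comparison_triangle (x y z : X) (a b c : 'rV[R]_2) : Prop :=
  [/\ edist a b = mdist x y, edist b c = mdist y z & edist c a = mdist z x].

(* [p'] in [a, b] is a comparison point for [p] on the side [x, y]. *)
Definition comparison_point (g : R -> X) (x y : X) (a b : 'rV[R]_2)
    (p : X) (p' : 'rV[R]_2) : Prop :=
  [/\ gsegment g x y p, esegment a b p' & edist a p' = mdist x p].

Definition triangle_comparison_point (gxy gyz gzx : R -> X) (x y z : X)
    (a b c : 'rV[R]_2) (p : X) (p' : 'rV[R]_2) : Prop :=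
  [\/ comparison_point gxy x y a b p p',
      comparison_point gyz y z b c p p' |
      comparison_point gzx z x c a p p'].

Definition gconvex (C : set X) : Prop :=
  forall x y g, C x -> C y -> geodesic g x y -> gsegment g x y `<=` C.

Definition bounded_seq (x : nat -> X) : Prop :=
  exists (z : X) (M : R), forall k, mdist z (x k) <= M.

Definition asymptotic_radius_at (x : nat -> X) (z : X) : \bar R :=
  limn_esup (fun k => (mdist z (x k))%:E).

Definition asymptotic_center (x : nat -> X) : set X :=
  [set z | forall y,
     (asymptotic_radius_at x z <= asymptotic_radius_at x y)%E].

Definition delta_cvg (x : nat -> X) (p : X) : Prop :=
  bounded_seq x /\
  forall phi : nat -> nat, {homo phi : i j / (i < j)%N} ->
    asymptotic_center (x \o phi) = [set p].

Definition fixed_points (C : set X) (T : X -> X) : set X :=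
  [set x | C x /\ T x = x].

Definition quasi_nonexpansive (C : set X) (T : X -> X) : Prop :=
  fixed_points C T !=set0 /\
  forall x q, C x -> fixed_points C T q -> mdist (T x) q <= mdist x q.

(* Families of mappings are indexed by k >= 1; the value at 0 of a
   [T : nat -> X -> X] plays no role. *)
Definition common_fixed_points (C : set X) (T : nat -> X -> X) : set X :=
  \bigcap_(k in [set k | (1 <= k)%N]) fixed_points C (T k).

Definition strongly_quasi_nonexpansive_seq (C : set X) (T : nat -> X -> X)
    : Prop :=
  [/\ forall k, (1 <= k)%N -> quasi_nonexpansive C (T k),
      common_fixed_points C T !=set0 &
      forall x : nat -> X, (forall k, C (x k)) -> bounded_seq x ->
        (exists2 q, common_fixed_points C T q &
           (fun k => mdist (x k) q - mdist (T k (x k)) q) @ \oo --> (0 : R)) ->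
        (fun k => mdist (x k) (T k (x k))) @ \oo --> (0 : R)].

Definition demiclosed_seq (C : set X) (T : nat -> X -> X) : Prop :=
  forall (x : nat -> X) (kk : nat -> nat) (p : X),
    (forall k, C (x k)) ->
    (forall j, (1 <= kk j)%N) -> {homo kk : i j / (i < j)%N} ->
    C p -> delta_cvg (x \o kk) p ->
    (fun j => mdist (x (kk j)) (T (kk j) (x (kk j)))) @ \oo --> (0 : R) ->
    common_fixed_points C T p.

(* T_k T_(k-1) ... T_1 z *)
Fixpoint iterated_comp (T : nat -> X -> X) (k : nat) (z : X) : X :=
  if k is j.+1 then T j.+1 (iterated_comp T j z) else z.

End Hadamard.

Definition geodesic_space {R : realType} (X : metricType R) : Prop :=
  forall x y : X, exists g, geodesic g x y.

Definition cat0 {R : realType} (X : metricType R) : Prop :=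
  geodesic_space X /\
  forall (x y z : X) (gxy gyz gzx : R -> X) (a b c : 'rV[R]_2),
    geodesic gxy x y -> geodesic gyz y z -> geodesic gzx z x ->
    comparison_triangle x y z a b c ->
    forall p q p' q',
      triangle_comparison_point gxy gyz gzx x y z a b c p p' ->
      triangle_comparison_point gxy gyz gzx x y z a b c q q' ->
      mdist p q <= edist p' q'.

Definition complete_metric {R : realType} (X : metricType R) : Prop :=
  forall u : nat -> X, cauchy (u @ \oo) -> exists l : X, u @ \oo --> l.

Definition hadamard {R : realType} (X : metricType R) : Prop :=
  complete_metric X /\ cat0 X.

(* Main.v *)
Require Import Defs.
From mathcomp Require Import all_boot all_order all_algebra.
From mathcomp Require Import all_classical all_reals all_analysis.
From mathcomp Require Import ring lra.
Import Order.TTheory GRing.Theory Num.Theory.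
Import numFieldNormedType.Exports.
Local Open Scope classical_set_scope.
Local Open Scope ring_scope.

(* Comparison with the plane makes squared distances, hence squared asymptotic
   radii, uniformly convex along geodesics, so their minimizers exist and are
   unique. This yields asymptotic centers, metric projections (so that centers
   of sequences of C stay in C) and, by a diagonal extraction,
   Delta-convergent subsequences. The orbit is Fejer monotone with respect to
   the set F of common fixed points, so d(q, x k) converges for q in F, and
   strong quasi-nonexpansiveness gives d(x k, T k (x k)) -> 0; by (D) every
   subsequence then has a further subsequence with Delta-limit in F. An
   Opial-type comparison of radii shows that all subsequences share one
   center. *)

Set Implicit Arguments.
Unset Strict Implicit.
Unset Printing Implicit Defensive.

(** * Comparison with the plane *)

(* Unqualified, [edist] is the extended distance of MathComp-Analysis. *)
Local Notation edist := Defs.edist.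

Section Plane.
Context {R : realType}.
Implicit Types a b c : 'rV[R]_2.

Definition point2 (u v : R) : 'rV[R]_2 :=
  \row_i if i == ord0 then u else v.

Lemma edist_sqr a b :
  edist a b ^+ 2 = (a 0 0 - b 0 0) ^+ 2 + (a 0 1 - b 0 1) ^+ 2.
Proof.
rewrite /edist sqr_sqrtr; last by apply: sumr_ge0 => i _; exact: sqr_ge0.
rewrite big_ord_recl big_ord1.
by congr (_ + (a _ _ - b _ _) ^+ 2); apply/val_inj.
Qed.

Lemma edist_ge0 a b : 0 <= edist a b.
Proof. exact: sqrtr_ge0. Qed.

Lemma edist_eq a b (d : R) : 0 <= d ->
  (a 0 0 - b 0 0) ^+ 2 + (a 0 1 - b 0 1) ^+ 2 = d ^+ 2 -> edist a b = d.
Proof.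
move=> d0 E; apply/eqP.
by rewrite -(eqrXn2 (n := 2)) ?edist_ge0// edist_sqr E.
Qed.

(** The side from [x] to [y] is laid on the first axis; the law of cosines gives the first
    coordinate [u] of the third vertex, and the triangle inequalities make its squared height
    nonnegative. *)
Lemma comparison_triangle_exists (X : metricType R) (x y z : X) :
  exists a b c, comparison_triangle x y z a b c.
Proof.
have [d1 d2 d3] : [/\ 0 <= mdist x y, 0 <= mdist y z & 0 <= mdist z x].
  by rewrite !mdist_ge0.
have t1 := metric_triangle y x z; have t2 := metric_triangle x y z.
have t3 := metric_triangle x z y.
rewrite (metric_sym x z) (metric_sym y x) (metric_sym z y) in t1 t2 t3.
rewrite /comparison_triangle.
move: (mdist x y) (mdist y z) (mdist z x) d1 d2 d3 t1 t2 t3.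
move=> c a b c0 a0 b0 t1 t2 t3.
have [cE|cN] := eqVneq c 0.
  have ab : a = b by lra.
  exists 0, 0, (point2 b 0); split; apply: edist_eq => //; rewrite !mxE /=.
  - by rewrite cE; ring.
  - by rewrite ab; ring.
  - by ring.
have cp : 0 < c by rewrite lt_neqAle eq_sym cN.
pose u := (c ^+ 2 + b ^+ 2 - a ^+ 2) / (2 * c).
have uE : 2 * c * u = c ^+ 2 + b ^+ 2 - a ^+ 2 by rewrite /u; field.
have v0 : 0 <= b ^+ 2 - u ^+ 2.
  rewrite subr_ge0 -(ler_pM2l (x := 4 * c ^+ 2)); last first.
    by rewrite mulr_gt0 ?exprn_gt0.
  have -> : 4 * c ^+ 2 * u ^+ 2 = (2 * c * u) ^+ 2 by ring.
  rewrite uE -subr_ge0.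
  (* Heron's factorization: the first three factors are nonnegative by the triangle inequalities. *)
  have -> : 4 * c ^+ 2 * b ^+ 2 - (c ^+ 2 + b ^+ 2 - a ^+ 2) ^+ 2 =
    ((a + b - c) * (a + c - b)) * ((b + c - a) * (a + b + c)) by ring.
  by rewrite !mulr_ge0//; lra.
exists 0, (point2 c 0), (point2 u (Num.sqrt (b ^+ 2 - u ^+ 2))).
split; apply: edist_eq => //; rewrite !mxE /=.
- by ring.
- rewrite sub0r sqrrN sqr_sqrtr//.
  have -> : (c - u) ^+ 2 = c ^+ 2 - 2 * c * u + u ^+ 2 by ring.
  by rewrite uE; ring.
- by rewrite !subr0 sqr_sqrtr//; ring.
Qed.

End Plane.

Section Cat0.
Context {R : realType} {X : metricType R}.

(* The comparison inequality between a vertex and a point of the opposite side,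
   evaluated in the plane by Stewart's theorem. *)
Lemma cat0_stewart (x y z : X) (g : R -> X) (t : R) :
  cat0 X -> geodesic g x y -> 0 <= t <= 1 ->
  mdist (g (t * mdist x y)) z ^+ 2 <=
    (1 - t) * mdist x z ^+ 2 + t * mdist y z ^+ 2
    - t * (1 - t) * mdist x y ^+ 2.
Proof.
move=> [geoX catX] gxy /andP[t0 t1].
have [gyz hyz] := geoX y z; have [gzx hzx] := geoX z x.
have [a [b [c tri]]] := comparison_triangle_exists x y z.
have [ab bc ca] := tri; have [gx gy gd] := gxy.
have [_ gyzz _] := hyz.
have d0 : 0 <= mdist x y by exact: mdist_ge0.
have td : t * mdist x y \in `[0, mdist x y].
  by rewrite in_itv/= mulr_ge0//= ler_piMl.
pose m := (1 - t) *: a + t *: b.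
have ame : edist a m = t * mdist x y.
  apply: edist_eq; first exact: mulr_ge0.
  rewrite /m exprMn -ab edist_sqr !mxE; ring.
have Cm : triangle_comparison_point g gyz gzx x y z a b c (g (t * mdist x y)) m.
  apply: Or31; split.
  - by exists (t * mdist x y).
  - by exists t => //=; rewrite in_itv/= t0.
  - rewrite ame -{2}gx gd// ?in_itv/= ?lexx//.
    by rewrite sub0r normrN ger0_norm// mulr_ge0.
(* The vertex [z] is taken as the endpoint of the side from [y] to [z]. *)
have Cz : triangle_comparison_point g gyz gzx x y z a b c z c.
  apply: Or32; split => //.
  - by exists (mdist y z) => //=; rewrite in_itv/= lexx mdist_ge0.
  - exists 1; first by rewrite /= in_itv/= ler01 lexx.
    by rewrite subrr scale0r add0r scale1r.
have /(lerXn2r 2) := catX _ _ _ _ _ _ _ _ _ gxy hyz hzx tri _ _ _ _ Cm Cz.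
rewrite !nnegrE mdist_ge0 edist_ge0 => /(_ isT isT) /le_trans; apply.
rewrite (metric_sym x z) -ab -bc -ca !edist_sqr /m !mxE.
by rewrite le_eqVlt; apply/orP; left; apply/eqP; ring.
Qed.

End Cat0.

(** * Minimizers of strongly convex functions *)

Lemma ler_add_small_mul {R : realFieldType} (a b c : R) :
  (forall e, 0 < e -> e <= 1 -> a <= b + e * c) -> a <= b.
Proof.
move=> H; rewrite leNgt; apply/negP => ba.
pose e := Num.min 1 ((a - b) / (2 * (`|c| + 1))).
have c1 : 0 < `|c| + 1 by rewrite ltr_wpDl.
have e0 : 0 < e by rewrite lt_min ltr01 divr_gt0 ?subr_gt0// mulr_gt0.
have e1 : e <= 1 by rewrite ge_min lexx.
have ec : e * (`|c| + 1) <= (a - b) / 2.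
  have : e <= (a - b) / (2 * (`|c| + 1)) by rewrite ge_min lexx orbT.
  by rewrite ler_pdivlMr ?mulr_gt0// => ?; lra.
have := H e e0 e1; have := ler_norm c; rewrite -(ler_pM2l e0) => *; lra.
Qed.

Section Minimizer.
Context {R : realType} {X : metricType R}.

(** Convexity is asked of the square, as for distances in a CAT(0) space, but the property is
    attached to [h], whose Lipschitz bound is used alongside it. *)
Definition sqr_strongly_gconvex (h : X -> R) : Prop :=
  forall (x y : X) (g : R -> X) (t : R), geodesic g x y -> 0 <= t <= 1 ->
    h (g (t * mdist x y)) ^+ 2 <=
      (1 - t) * h x ^+ 2 + t * h y ^+ 2 - t * (1 - t) * mdist x y ^+ 2.

Lemma dist_sqr_strongly_gconvex (z : X) :
  cat0 X -> sqr_strongly_gconvex (mdist^~ z).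
Proof. by move=> cX x y g t gxy t01; exact: cat0_stewart. Qed.

(** Midpoint convexity makes a minimizing sequence Cauchy, and the Lipschitz bound makes its limit a
    minimizer. The quadratic gap, which yields uniqueness, comes from convexity near the limit. *)
Lemma sqr_minimizer_exists (K : set X) (h : X -> R) :
  hadamard X -> K !=set0 -> closed K -> gconvex K ->
  (forall x, 0 <= h x) -> (forall x y, h x <= h y + mdist x y) ->
  sqr_strongly_gconvex h ->
  exists2 p, K p & forall y, K y -> h p ^+ 2 + mdist p y ^+ 2 <= h y ^+ 2.
Proof.
move=> [complX [geoX _]] [x0 Kx0] clK cvK h0 hL hC.
pose E := (fun x => h x ^+ 2) @` K.
pose m := inf E.
have E_lb : has_lbound E by exists 0 => _ [x _ <-]; exact: sqr_ge0.
have E_inf : has_inf E by split => //; exists (h x0 ^+ 2), x0.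
have mle x : K x -> m <= h x ^+ 2 by move=> Kx; apply: ge_inf => //; exists x.
have m0 : 0 <= m.
  by apply: lb_le_inf; [case: E_inf|move=> _ [x _ <-]; exact: sqr_ge0].
have convK x y g t : K x -> K y -> geodesic g x y -> 0 <= t <= 1 ->
    K (g (t * mdist x y)).
  move=> Kx Ky gxy /andP[t0 t1]; apply: (cvK _ _ _ Kx Ky gxy).
  exists (t * mdist x y) => //=.
  by rewrite in_itv/= mulr_ge0 ?mdist_ge0//= ler_piMl ?mdist_ge0.
have near_min n : exists u, K u /\ h u ^+ 2 < m + n.+1%:R^-1.
  have /inf_adherent/(_ E_inf)[_ [u Ku <-] hu] : (0 : R) < n.+1%:R^-1 by [].
  by exists u.
have [u uP] := choice near_min.
(* Convexity at t = 1/2, with [m] bounding the value at the midpoint from below. *)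
have par x y : K x -> K y -> mdist x y ^+ 2 <= 2 * (h x ^+ 2 + h y ^+ 2) - 4 * m.
  move=> Kx Ky; have [g gxy] := geoX x y.
  have half : 0 <= (2^-1 : R) <= 1 by rewrite invr_ge0 invf_le1 ?ler0n ?ler1n.
  have := hC _ _ _ _ gxy half; have := mle _ (convK _ _ _ _ Kx Ky gxy half).
  by move=> *; lra.
have Cu : cauchy (u @ \oo).
  apply: cauchy_exP => e e0.
  have e4 : 0 < e ^+ 2 / 4 by rewrite divr_gt0// exprn_gt0.
  have [N _ NP] := near_infty_natSinv_lt (PosNum e4).
  have {}NP n : (N <= n)%N -> n.+1%:R^-1 < e ^+ 2 / 4 by exact: NP.
  exists (u N), N => //= n /= Nn; rewrite ballEmdist /=.
  have [[KN hN] [Kn hn]] := (uP N, uP n).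
  have := par _ _ KN Kn; have aN := NP N (leqnn N); have an := NP n Nn => dNn.
  rewrite -(@ltr_pXn2r _ 2) ?nnegrE ?mdist_ge0 ?(ltW e0)//.
  move: hN hn aN an dNn.
  move: (N.+1%:R^-1) (n.+1%:R^-1) => a b; clearbody m => *; lra.
have [l ul] := complX u Cu.
have Kl : K l by by apply: (closed_cvg K clK _ l ul); near=> n; case: (uP n).
(* Otherwise let [e] be half the gap between [h l] and [s]. For large [n], [h (u n) ^+ 2 < m + e ^+
   2 <= (s + e) ^+ 2], and the Lipschitz bound gives [h l < s + 2 * e = h l]. *)
have hl : h l ^+ 2 <= m.
  rewrite leNgt; apply/negP => mh.
  pose s := Num.sqrt m.
  have s0 : 0 <= s by exact: sqrtr_ge0.
  have sE : s ^+ 2 = m by rewrite sqr_sqrtr.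
  have sh : s < h l by rewrite -(@ltr_pXn2r _ 2) ?nnegrE// sE.
  pose e := (h l - s) / 2.
  have eE : 2 * e = h l - s by rewrite /e; field.
  have e0 : 0 < e by rewrite /e; lra.
  clearbody e s m.
  have e2 : 0 < e ^+ 2 by rewrite exprn_gt0.
  have : \forall n \near \oo, h l < h l.
    near=> n.
    have d1 : mdist l (u n) < e.
      by near: n; exact: (metricType_numDomainType.cvgr_dist_lt ul).
    have d2 : n.+1%:R^-1 < e ^+ 2.
      by near: n; exact: (near_infty_natSinv_lt (PosNum e2)).
    have hun : h (u n) < s + e.
      rewrite -(@ltr_pXn2r _ 2) ?nnegrE ?h0 ?addr_ge0 ?(ltW e0)//.
      have [_ hn] := uP n; apply: (lt_le_trans hn).
      have : 0 <= s * e by rewrite mulr_ge0// ltW.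
      by rewrite sqrrD sE => *; move: d2; move: (n.+1%:R^-1) => b *; lra.
    by have := hL l (u n) => *; lra.
  by case/filter_ex => n; rewrite ltxx.
exists l => // y Ky; have [g gly] := geoX l y.
(* Compare [l] with the point at parameter [t] towards [y], divide by [t], and let [t] tend to 0. *)
apply: (@ler_add_small_mul _ _ _ (mdist l y ^+ 2)) => t t0 t1.
have t01 : 0 <= t <= 1 by rewrite (ltW t0) t1.
have := hC _ _ _ _ gly t01.
have := mle _ (convK _ _ _ _ Kl Ky gly t01).
move=> h1 h2; rewrite -(ler_pM2l t0).
by lra.
Unshelve. all: by end_near. Qed.

End Minimizer.

(** * Asymptotic radii *)

(** Infinite index sets encode subsequences, so that passing to a further subsequence is
    inclusion. *)
Definition cofinal_set (A : set nat) : Prop :=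
  forall N, exists2 k, (N <= k)%N & A k.

Definition almost_subset (A B : set nat) : Prop :=
  exists N, forall k, (N <= k)%N -> A k -> B k.

Lemma cofinal_almost_subset (A B : set nat) :
  almost_subset A B -> cofinal_set A -> cofinal_set (A `&` B).
Proof.
move=> [M AB] cA N; have [k] := cA (maxn M N); rewrite geq_max => /andP[Mk Nk] Ak.
by exists k => //; split => //; exact: AB.
Qed.

Lemma sub_cofinal_set (A B : set nat) :
  A `<=` B -> cofinal_set A -> cofinal_set B.
Proof. by move=> AB cA N; have [k Nk /AB] := cA N; exists k. Qed.

Lemma homo_ltn_ge_id (phi : nat -> nat) :
  {homo phi : i j / (i < j)%N} -> forall n, (n <= phi n)%N.
Proof.
by move=> hphi; elim=> // n /leq_ltn_trans; apply; exact: hphi.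
Qed.

Lemma cofinal_range (phi : nat -> nat) :
  {homo phi : i j / (i < j)%N} -> cofinal_set (range phi).
Proof.
by move=> hphi N; exists (phi N); [exact: homo_ltn_ge_id|exists N].
Qed.

Section AsymptoticRadius.
Context {R : realType} {X : metricType R}.
Implicit Types (s : nat -> X) (A B : set nat) (p q : X).

Definition eventually_within s A p (a : R) : Prop :=
  exists N, forall k, (N <= k)%N -> A k -> mdist p (s k) <= a.

(* Asymptotic radius along the subsequence enumerating A: the number
   limsup d(p, s k) as k goes to infinity inside A. *)
Definition subseq_radius s A p : R := inf [set a | eventually_within s A p a].

Section Fixed.
Context {s : nat -> X} (bs : bounded_seq s).

Lemma radius_has_inf A p : cofinal_set A ->
  has_inf [set a | eventually_within s A p a].
Proof.
move=> cA; split; last first.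
  exists 0 => a [N H]; have [k Nk Ak] := cA N.
  by rewrite (le_trans _ (H k Nk Ak))// mdist_ge0.
have [z [M zM]] := bs; exists (mdist p z + M), 0%N => k _ _.
by rewrite (le_trans (metric_triangle p z _))// lerD2l.
Qed.

Lemma radius_le A p a : cofinal_set A ->
  eventually_within s A p a -> subseq_radius s A p <= a.
Proof. by move=> cA ev; have [_ lb] := radius_has_inf p cA; exact: ge_inf. Qed.

Lemma radius_within A p e : cofinal_set A -> 0 < e ->
  eventually_within s A p (subseq_radius s A p + e).
Proof.
move=> cA e0; have [a [N aN] ae] := inf_adherent e0 (radius_has_inf p cA).
by exists N => k Nk Ak; rewrite (le_trans (aN k Nk Ak))// ltW.
Qed.

Lemma radius_ge0 A p : cofinal_set A -> 0 <= subseq_radius s A p.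
Proof.
move=> cA; apply/ler_addgt0Pr => e e0.
have [N H] := radius_within p cA e0; have [k Nk Ak] := cA N.
by rewrite (le_trans _ (H k Nk Ak))// mdist_ge0.
Qed.

Lemma radius_lipschitz A p q : cofinal_set A ->
  subseq_radius s A p <= subseq_radius s A q + mdist p q.
Proof.
move=> cA; apply/ler_addgt0Pr => e e0.
have [N H] := radius_within q cA e0; apply: radius_le => //.
exists N => k Nk Ak; rewrite (le_trans (metric_triangle p q _))//.
by have := H k Nk Ak; lra.
Qed.

Lemma radius_almost_subset A B p : cofinal_set A -> almost_subset A B ->
  subseq_radius s A p <= subseq_radius s B p.
Proof.
move=> cA AB; have cB : cofinal_set B.
  exact: sub_cofinal_set (cofinal_almost_subset AB cA).
apply/ler_addgt0Pr => e e0; apply: radius_le => //.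
have [M AM] := AB; have [N H] := radius_within p cB e0.
exists (maxn M N) => k; rewrite geq_max => /andP[Mk Nk] Ak.
by apply: H => //; exact: AM.
Qed.

(** Stewart's inequality holds for each far term of the sequence, with distances bounded by the
    radii plus [e]; then [e] tends to 0. *)
Lemma radius_sqr_strongly_gconvex A :
  cat0 X -> cofinal_set A -> sqr_strongly_gconvex (subseq_radius s A).
Proof.
move=> cX cA x y g t gxy t01; have /andP[t0 t1] := t01.
have rx := radius_ge0 x cA; have ry := radius_ge0 y cA.
apply: (@ler_add_small_mul _ _ _
  (2 * (subseq_radius s A x + subseq_radius s A y) + 1)) => e e0 e1.
have [N1 H1] := radius_within x cA e0.
have [N2 H2] := radius_within y cA e0.
set rx' := subseq_radius s A x in rx H1 *; set ry' := subseq_radius s A y in ry H2 *.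
pose d := mdist x y.
pose Q := (1 - t) * (rx' + e) ^+ 2 + t * (ry' + e) ^+ 2 - t * (1 - t) * d ^+ 2.
have HQ k : (maxn N1 N2 <= k)%N -> A k -> mdist (g (t * d)) (s k) ^+ 2 <= Q.
  rewrite geq_max => /andP[k1 k2] Ak.
  apply: (le_trans (cat0_stewart (s k) cX gxy t01)); rewrite /Q lerD2r lerD//.
    apply: ler_wpM2l; first by lra.
    by rewrite ler_pXn2r ?nnegrE ?mdist_ge0 ?addr_ge0 ?(ltW e0)// H1.
  apply: ler_wpM2l => //.
  by rewrite ler_pXn2r ?nnegrE ?mdist_ge0 ?addr_ge0 ?(ltW e0)// H2.
(* [Q] dominates a square at some index of [A], so its square root is a genuine bound. *)
have Q0 : 0 <= Q.
  have [k Nk Ak] := cA (maxn N1 N2).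
  by apply: le_trans (HQ k Nk Ak); exact: sqr_ge0.
have : subseq_radius s A (g (t * d)) <= Num.sqrt Q.
  apply: radius_le => //; exists (maxn N1 N2) => k Nk Ak.
  rewrite -(@ler_pXn2r _ 2) ?nnegrE ?mdist_ge0 ?sqrtr_ge0// sqr_sqrtr//.
  exact: HQ.
rewrite -(@ler_pXn2r _ 2) ?nnegrE ?radius_ge0 ?sqrtr_ge0// sqr_sqrtr//.
move=> /le_trans; apply; rewrite /Q -/d.
clearbody rx' ry' d.
rewrite -subr_ge0.
have -> : (1 - t) * rx' ^+ 2 + t * ry' ^+ 2 - t * (1 - t) * d ^+ 2 +
  e * (2 * (rx' + ry') + 1) -
  ((1 - t) * (rx' + e) ^+ 2 + t * (ry' + e) ^+ 2 - t * (1 - t) * d ^+ 2) =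
  e * (2 * (t * rx' + (1 - t) * ry') + (1 - e)) by ring.
rewrite mulr_ge0 ?(ltW e0)// addr_ge0 ?subr_ge0// mulr_ge0//.
by rewrite addr_ge0 ?mulr_ge0 ?subr_ge0.
Qed.

Lemma center_exists A : hadamard X -> cofinal_set A ->
  exists p, forall y,
    subseq_radius s A p ^+ 2 + mdist p y ^+ 2 <= subseq_radius s A y ^+ 2.
Proof.
move=> hX cA.
have [|||||| p _ H] := @sqr_minimizer_exists R X setT (subseq_radius s A) hX.
- by exists (s 0%N).
- exact: closedT.
- by [].
- by move=> p; exact: radius_ge0.
- by move=> p q; exact: radius_lipschitz.
- by apply: radius_sqr_strongly_gconvex => //; case: hX.
by exists p => y; exact: H.
Qed.

End Fixed.
End AsymptoticRadius.

(** * Asymptotic centers *)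

Section AsymptoticCenter.
Context {R : realType} {X : metricType R}.
Implicit Types (s : nat -> X) (A B : set nat) (p q : X).

Definition center_of s A p : Prop :=
  forall y, subseq_radius s A p ^+ 2 + mdist p y ^+ 2 <= subseq_radius s A y ^+ 2.

Lemma mdist_sqr_le0 p q : mdist p q ^+ 2 <= 0 -> p = q.
Proof.
move=> pq; apply: mdist_positivity; apply/eqP.
by rewrite -sqrf_eq0 eq_le pq sqr_ge0.
Qed.

Lemma eq_radius s s' A :
  (exists N, forall k, (N <= k)%N -> s k = s' k) ->
  subseq_radius s A = subseq_radius s' A.
Proof.
move=> [M ss']; apply/funext => p; rewrite /subseq_radius; congr inf.
by apply/seteqP; split => a [N H]; exists (maxn M N) => k;
  rewrite geq_max => /andP[Mk Nk] Ak; [rewrite -ss'//|rewrite ss'//]; exact: H.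
Qed.

Section Fixed.
Context {s : nat -> X} (bs : bounded_seq s).

Lemma center_radius_le A p y : cofinal_set A -> center_of s A p ->
  subseq_radius s A p <= subseq_radius s A y.
Proof.
move=> cA /(_ y) H.
rewrite -(@ler_pXn2r _ 2) ?nnegrE ?radius_ge0//.
by apply: le_trans H; rewrite lerDl sqr_ge0.
Qed.

Lemma center_eq A p q : cofinal_set A -> center_of s A p ->
  subseq_radius s A q <= subseq_radius s A p -> p = q.
Proof.
move=> cA /(_ q) H qp; apply: mdist_sqr_le0.
have : subseq_radius s A q ^+ 2 <= subseq_radius s A p ^+ 2.
  by rewrite ler_pXn2r ?nnegrE ?radius_ge0.
by move=> *; lra.
Qed.

(** The projection of the center onto [C] is no farther from any point of [C] than the center
    itself, so its radius is no larger, and uniqueness identifies the two. *)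
Lemma center_in_closed_convex (C : set X) A p :
  hadamard X -> closed C -> gconvex C -> (forall k, C (s k)) ->
  cofinal_set A -> center_of s A p -> C p.
Proof.
move=> hX clC cvC Cs cA cp.
have [|||| pr Cpr H] := @sqr_minimizer_exists R X C (mdist^~ p) hX _ clC cvC.
- by exists (s 0%N).
- by move=> x; exact: mdist_ge0.
- by move=> x y; rewrite addrC; exact: metric_triangle.
- by apply: dist_sqr_strongly_gconvex; case: hX.
suff -> : p = pr by [].
apply: (center_eq cA cp).
apply/ler_addgt0Pr => e e0; apply: radius_le => //.
have [N HN] := radius_within bs p cA e0; exists N => k Nk Ak.
apply: le_trans (HN k Nk Ak).
rewrite -(@ler_pXn2r _ 2) ?nnegrE ?mdist_ge0// (metric_sym p).
by apply: le_trans (H _ (Cs k)); rewrite lerDr sqr_ge0.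
Qed.

(** * Minimal radii and regular subsequences *)

Definition min_radius A : R := inf (range (subseq_radius s A)).

Lemma min_radius_le A y : cofinal_set A -> min_radius A <= subseq_radius s A y.
Proof.
move=> cA; apply: ge_inf; last by exists y.
by exists 0 => _ [z _ <-]; exact: radius_ge0.
Qed.

Lemma le_min_radius A a :
  (forall y, a <= subseq_radius s A y) -> a <= min_radius A.
Proof.
move=> H; apply: lb_le_inf; last by move=> _ [y _ <-].
by exists (subseq_radius s A (s 0%N)), (s 0%N).
Qed.

Lemma min_radius_almost_subset A B : cofinal_set A -> almost_subset A B ->
  min_radius A <= min_radius B.
Proof.
move=> cA AB; apply: le_min_radius => y.
exact: le_trans (min_radius_le y cA) (radius_almost_subset bs y cA AB).
Qed.

Lemma near_minimal_subset A e : cofinal_set A -> 0 < e ->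
  exists B, [/\ cofinal_set B, B `<=` A &
    forall B', cofinal_set B' -> B' `<=` A -> min_radius B <= min_radius B' + e].
Proof.
move=> cA e0; pose E := min_radius @` [set B | cofinal_set B /\ B `<=` A].
have Elb : has_lbound E.
  exists 0 => _ [B [cB _] <-]; apply: le_min_radius => y; exact: radius_ge0.
have Einf : has_inf E by split => //; exists (min_radius A); exists A; split.
have [_ [B [cB BA] <-] BE] := inf_adherent e0 Einf.
exists B; split => // B' cB' B'A; apply: (le_trans (ltW BE)).
by rewrite lerD2r; apply: ge_inf => //; exists B'.
Qed.

(* Diagonal extraction along a decreasing chain of index sets whose minimal
   radii are smaller and smaller relative to those of their subsets. *)
Lemma regular_subsequence A : cofinal_set A ->
  exists D : nat -> nat, [/\ {homo D : i j / (i < j)%N}, range D `<=` A &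
    forall B, cofinal_set B -> B `<=` range D ->
      min_radius (range D) <= min_radius B].
Proof.
move=> cA.
have step (An : set nat * nat) : exists B, cofinal_set An.1 ->
    [/\ cofinal_set B, B `<=` An.1 &
      forall B', cofinal_set B' -> B' `<=` An.1 ->
      min_radius B <= min_radius B' + An.2.+1%:R^-1].
  (* [setT] is only a default value: every set of the chain [F] is cofinal. *)
  have [c1|n1] := pselect (cofinal_set An.1); last by exists setT => /n1.
  have e0 : (0 : R) < An.2.+1%:R^-1 by [].
  have [B HB] := near_minimal_subset c1 e0.
  by exists B.
have [f fP] := choice step.
pose F := fix F n := if n is m.+1 then f (F m, m) else A.
have cF n : cofinal_set (F n) by elim: n => //= n /(fP (F n, n)) [].
have FS n : F n.+1 `<=` F n by have [] := fP (F n, n) (cF n).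
have Fle m n : (m <= n)%N -> F n `<=` F m.
  elim: n => [|n IH]; first by rewrite leqn0 => /eqP ->.
  by rewrite leq_eqVlt => /orP[/eqP -> //|/IH]; exact: subset_trans.
have pick (nN : nat * nat) : exists k, (nN.2 <= k)%N /\ F nN.1 k.
  by have [k ? ?] := cF nN.1 nN.2; exists k.
have [g gP] := choice pick.
pose D := fix D n := if n is m.+1 then g (m.+1, (D m).+1) else g (0, 0)%N.
have FD n : F n (D n).
  by case: n => [|n]; [have [] := gP (0, 0)%N|have [] := gP (n.+1, (D n).+1)].
have hD : {homo D : i j / (i < j)%N}.
  apply: homo_ltn; first exact: ltn_trans.
  by move=> n; have [] := gP (n.+1, (D n).+1).
have DF n : almost_subset (range D) (F n).
  exists (D n) => k Dn [j _ jk]; rewrite -jk; apply: (Fle n j _ _ (FD j)).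
  by rewrite -(leq_mono hD) jk.
exists D; split => //.
  by move=> _ [n _ <-]; exact: (Fle 0%N n (leq0n n) _ (FD n)).
move=> B cB BD; apply/ler_addgt0Pr => e e0.
have [n _ ne] := near_infty_natSinv_lt (PosNum e0).
have cD := cofinal_range hD.
(* The chain of bounds goes from [range D] to [F n.+1], then at cost 1/(n+1) to the subset [B] meets
   [F n] of [F n], and finally to [B]. *)
have BF : almost_subset B (F n).
  by have [N H] := DF n; exists N => k Nk /BD; exact: H.
have cBF := cofinal_almost_subset BF cB.
have [_ _ /(_ (B `&` F n) cBF)] := fP (F n, n) (cF n).
move=> /(_ (@subIsetr _ _ _)) h1.
apply: (le_trans (min_radius_almost_subset cD (DF n.+1))).
apply: (le_trans h1); apply: lerD; last exact/ltW/(ne n)/leqnn.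
by apply: min_radius_almost_subset => //; exists 0%N => k _ [].
Qed.

(** Shrinking [range D] to [B] cannot raise the radius at [p], and regularity prevents the minimal
    radius from dropping, so [p] still minimizes. *)
Lemma common_center_subsequence A : hadamard X -> cofinal_set A ->
  exists (D : nat -> nat) (p : X), [/\ {homo D : i j / (i < j)%N},
    range D `<=` A &
    forall B, cofinal_set B -> B `<=` range D -> center_of s B p].
Proof.
move=> hX cA; have [D [hD DA Dreg]] := regular_subsequence cA.
have cD := cofinal_range hD.
have [p cp] := center_exists bs hX cD.
exists D, p; split => // B cB BD.
have [q cq] := center_exists bs hX cB.
suff <- : q = p by [].
apply: (center_eq cB cq).
have BD' : almost_subset B (range D) by exists 0%N => k _; exact: BD.
apply: (le_trans (radius_almost_subset bs p cB BD')).
apply: le_trans (min_radius_le q cB).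
apply: le_trans (Dreg B cB BD).
by apply: le_min_radius => y; exact: center_radius_le.
Qed.

(** * Agreement with [asymptotic_center] and Delta-convergence *)

Lemma asymptotic_radius_atE (phi : nat -> nat) p :
  {homo phi : i j / (i < j)%N} ->
  asymptotic_radius_at (s \o phi) p = (subseq_radius s (range phi) p)%:E.
Proof.
move=> hphi; have cphi := cofinal_range hphi.
apply/eqP; rewrite eq_le; apply/andP; split.
  apply/lee_addgt0Pr => e e0; rewrite -EFinD.
  have [N H] := radius_within bs p cphi e0.
  apply: (@le_trans _ _ (ereal_sup
    ((fun k => (mdist p (s (phi k)))%:E) @` [set k | (N <= k)%N]))).
    by apply: ereal_inf_lbound; exists [set k | (N <= k)%N] => //; exists N.
  apply: ge_ereal_sup => _ [k /= Nk <-]; rewrite lee_fin; apply: H; last by exists k.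
  exact: leq_trans Nk (homo_ltn_ge_id hphi k).
apply: le_ereal_inf_tmp => _ [V [N _ NV] <-].
have ub k : (N <= k)%N ->
    ((mdist p (s (phi k)))%:E <=
      ereal_sup ((fun k => (mdist p ((s \o phi) k))%:E) @` V))%E.
  by move=> Nk; apply: ereal_sup_ubound; exists k => //; exact: NV.
move: ub; case: (ereal_sup _) => [a| |] ub.
(* The threshold [phi N] on values of [phi] forces arguments at least [N]. *)
- rewrite lee_fin; apply: radius_le => //; exists (phi N) => i phiNi [k _ kE].
  rewrite -kE.
  by rewrite -lee_fin; apply: ub; rewrite -(leq_mono hphi) kE.
- by rewrite leey.
- by have := ub N (leqnn N).
Qed.

Lemma asymptotic_center_eq (phi : nat -> nat) p :
  {homo phi : i j / (i < j)%N} -> center_of s (range phi) p ->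
  asymptotic_center (s \o phi) = [set p].
Proof.
move=> hphi cp; have cphi := cofinal_range hphi.
apply/seteqP; split => [q /(_ p)|_ -> y]; rewrite !asymptotic_radius_atE// lee_fin.
  by move=> /(center_eq cphi cp).
exact: center_radius_le.
Qed.

End Fixed.

Lemma delta_cvg_centers s (D : nat -> nat) p : bounded_seq s ->
  {homo D : i j / (i < j)%N} ->
  (forall B, cofinal_set B -> B `<=` range D -> center_of s B p) ->
  delta_cvg (s \o D) p.
Proof.
move=> bs hD cp; split; first by have [z [M zM]] := bs; exists z, M => k; exact: zM.
move=> phi hphi; have hDphi : {homo D \o phi : i j / (i < j)%N}.
  by move=> i j ij; exact/hD/hphi.
apply: (asymptotic_center_eq bs hDphi); apply: cp; first exact: cofinal_range.
by move=> _ [k _ <-]; exists (phi k).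
Qed.

Lemma radius_cvg s A p l : bounded_seq s -> cofinal_set A ->
  (fun k => mdist p (s k)) @ \oo --> (l : R) -> subseq_radius s A p = l.
Proof.
move=> bs cA /cvgrPdist_le sl; apply/eqP; rewrite eq_le; apply/andP; split;
  apply/ler_addgt0Pr => e e0.
- have [N _ H] := sl e e0; apply: radius_le => //; exists N => k Nk _.
  by have := H k Nk; rewrite /= ler_norml => /andP[]; lra.
- have e2 : 0 < e / 2 by rewrite divr_gt0.
  have [N _ H] := sl _ e2; have [M HM] := radius_within bs p cA e2.
  have [k] := cA (maxn M N); rewrite geq_max => /andP[Mk Nk] Ak.
  have := HM k Mk Ak; have := H k Nk; rewrite /= ler_norml => /andP[].
  by move=> *; lra.
Qed.

(* Opial-type argument: on F the radius does not depend on the subsequence, so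
   centers of subsequences that lie in F must all agree. *)
Lemma unique_center s (F : set X) : hadamard X -> bounded_seq s ->
  (forall q, F q -> cvgn (fun k => mdist q (s k))) ->
  (forall A, cofinal_set A -> exists (D : nat -> nat) (p : X),
     [/\ {homo D : i j / (i < j)%N}, range D `<=` A, F p &
         center_of s (range D) p]) ->
  exists2 p, F p & forall A, cofinal_set A -> center_of s A p.
Proof.
move=> hX bs Fcvg Fsub.
have radF q A B : F q -> cofinal_set A -> cofinal_set B ->
    subseq_radius s A q = subseq_radius s B q.
  by move=> /Fcvg sq cA cB; rewrite (radius_cvg bs cA sq) (radius_cvg bs cB sq).
(* Along [D] the center is [p] in [F], so the radius at [p] is at most that at [u]. It is the same
   along [A], where the radius at [u] can only be larger; hence [u = p]. *)
have centerF A u : cofinal_set A -> center_of s A u -> F u.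
  move=> cA cu; have [D [p [hD DA Fp cp]]] := Fsub A cA.
  have cD := cofinal_range hD.
  suff -> : u = p by [].
  apply: (center_eq bs cA cu); rewrite (radF p A (range D))//.
  apply: (le_trans (center_radius_le bs u cD cp)).
  by apply: radius_almost_subset => //; exists 0%N => k _; exact: DA.
have cT : cofinal_set setT by move=> N; exists N.
have [p cp] := center_exists bs hX cT.
have Fp := centerF _ _ cT cp.
exists p => // A cA; have [u cu] := center_exists bs hX cA.
suff <- : u = p by [].
have Fu := centerF _ _ cA cu.
(* Both points lie in [F], so their radii along [A] compare as along the whole sequence, where [p]
   is minimal. *)
apply: (center_eq bs cA cu); rewrite (radF p A setT)// (radF u A setT)//.
exact: center_radius_le.
Qed.

End AsymptoticCenter.

(** * Fejer monotone orbits *)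

Section Orbit.
Context {R : realType} {X : metricType R}.

Lemma sqn_orbit_delta_cvg_centers (C : set X) (T : nat -> X -> X)
    (z : nat -> X) :
  hadamard X -> closed C -> gconvex C ->
  strongly_quasi_nonexpansive_seq C T -> demiclosed_seq C T ->
  (forall k, C (z k)) -> z 1%N = z 0%N ->
  (forall k, (1 <= k)%N -> z k.+1 = T k (z k)) ->
  bounded_seq z /\ exists2 p, common_fixed_points C T p &
    forall A, cofinal_set A -> center_of z A p.
Proof.
move=> hX clC cvC [qne [q0 Fq0] sqn] hD Cz z1 zS.
set F := common_fixed_points C T.
have zdec q : F q ->
    {homo (fun k => mdist q (z k)) : m n / (m <= n)%N >-> n <= m}.
  move=> Fq; apply/nonincreasing_seqP => -[|k]; first by rewrite z1.
  have k1 : (1 <= k.+1)%N by [].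
  have [_ /(_ (z k.+1) q (Cz _) (Fq _ k1))] := qne _ k1.
  by rewrite (zS k.+1)// (metric_sym q (T _ _)) (metric_sym q (z _)).
have bz : bounded_seq z.
  by exists q0, (mdist q0 (z 0%N)) => k; exact: zdec.
have zcvg q : F q -> cvgn (fun k => mdist q (z k)).
  move=> Fq; apply: nonincreasing_is_cvgn; first exact: zdec.
  by exists 0 => _ [k _ <-]; exact: mdist_ge0.
have zT : (fun k => mdist (z k) (T k (z k))) @ \oo --> (0 : R).
  apply: sqn => //; exists q0 => //.
  (* Consecutive differences of a convergent sequence tend to 0; from index 1 on they are those in
     the strong quasi-nonexpansiveness condition. *)
  have /cvg_ex[/= l zl] := zcvg q0 Fq0.
  have zl1 : (fun k => mdist q0 (z k.+1)) @ \oo --> l.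
    by rewrite (cvg_shiftS (fun k => mdist q0 (z k))).
  have zl0 : (fun k => mdist q0 (z k) - mdist q0 (z k.+1)) @ \oo --> (0 : R).
    by rewrite -(subrr l); exact: cvgB.
  apply: (cvg_trans (near_eq_cvg _) zl0); exists 1%N => // k k1.
  by rewrite -zS// !(metric_sym q0).
split => //; apply: unique_center => // A cA.
(* Removing index 0 meets the requirement in (D) that indices be at least 1. *)
have cA1 : cofinal_set (A `&` [set k | (1 <= k)%N]).
  by apply: cofinal_almost_subset => //; exists 1%N.
have [D [p [hDD DA cp]]] := common_center_subsequence bz hX cA1.
have cD := cofinal_range hDD.
have cDp : center_of z (range D) p by exact: cp.
exists D, p; split => //; first by move=> k /DA[].
apply: (hD z D p) => //.
- by move=> j; have [] := DA (D j) (ex_intro2 _ _ j I erefl).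
- exact: center_in_closed_convex cDp.
- exact: delta_cvg_centers.
- have Doo : D @ \oo --> \oo.
    move=> P [N _ NP]; exists N => // n /= Nn; apply: NP => /=.
    exact: leq_trans Nn (homo_ltn_ge_id hDD n).
  exact: cvg_comp Doo zT.
Qed.

Lemma bounded_seq_eventually (s s' : nat -> X) :
  (exists N, forall k, (N <= k)%N -> s k = s' k) ->
  bounded_seq s -> bounded_seq s'.
Proof.
move=> [N ss'] [z [M zM]]; exists z.
exists (Num.max M (\big[Num.max/0]_(i < N) mdist z (s' i))) => k.
have [Nk|kN] := leqP N k; first by rewrite -ss'// le_max zM.
by rewrite le_max (le_bigmax _ (fun i : 'I_N => mdist z (s' i)) (Ordinal kN)) orbT.
Qed.

End Orbit.

Unset Implicit Arguments.

Theorem theorem2p1 (R : realType) (X : metricType R) (C : set X)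
    (T : nat -> X -> X) (x : nat -> X)
    (hX : hadamard X) (hCclosed : closed C) (hCconvex : gconvex C)
    (hT : forall k, (1 <= k)%N -> forall z, C z -> C (T k z))
    (hSQN : strongly_quasi_nonexpansive_seq C T)
    (hD : demiclosed_seq C T)
    (hx0 : C (x 0%N))
    (hx : forall k, (1 <= k)%N -> x k.+1 = iterated_comp T k (x 0%N)) :
  exists p, common_fixed_points C T p /\ delta_cvg x p.
Proof.
(* [x 1] is unconstrained: work with the orbit [z] that has [z 1 = x 0]. *)
pose z k := iterated_comp T k.-1 (x 0%N).
have Cz k : C (z k) by rewrite /z; elim: k.-1 => //= n; exact: hT.
have zS k : (1 <= k)%N -> z k.+1 = T k (z k) by case: k.
have [bz [p Fp cp]] :=
  sqn_orbit_delta_cvg_centers hX hCclosed hCconvex hSQN hD Cz erefl zS.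
(* The recursion prescribes [x] from index 2 on, where it agrees with [z]. *)
have zx : exists N, forall k, (N <= k)%N -> z k = x k.
  by exists 2%N => -[|[|k]] // _; rewrite hx.
exists p; split => //.
have bx := bounded_seq_eventually zx bz.
(* With [id] as the extraction, every cofinal set is admissible; radii depend only on tails, so the
   centers of [z] serve for [x]. *)
apply: (@delta_cvg_centers _ _ x id) => // B cB _ y.
by rewrite -(eq_radius _ zx); exact: cp.
Qed.
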